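(* There is an absolute constant $c>0$ such that the following holds. Let $F$ be a field of odd positive characteristic $p$, and let $A\subset F_*=F\setminus\{0\}$ be a finite set with $|A|>1$ and $|A|<p^{3/5}$. Then $$|A+A|^3\,|AA|^2\ \ge\ c\,|A|^6 .$$
   Context: $A+A=\{a+b: a,b\in A\}$ and $AA=\{ab: a,b\in A\}$. *)

(* Defs.v *)
From HB Require Import structures.
From mathcomp Require Import all_boot all_order all_algebra finmap.

Set Implicit Arguments.
Unset Strict Implicit.
Unset Printing Implicit Defensive.

Import GRing.Theory.
Local Open Scope ring_scope.
Local Open Scope fset_scope.

Definition sumset (F : fieldType) (A B : {fset F}) : {fset F} :=
  [fset a + b | a in A, b in B]%R.

Definition prodset (F : fieldType) (A B : {fset F}) : {fset F} :=
  [fset a * b | a in A, b in B]%R.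

(* Main.v *)
(* Elekes's construction reduces the bound to counting the collisions
   a (x - b) = a' (x' - b') with a, b, a', b' in A and x, x' in A + A: by
   Cauchy-Schwarz there are at least |A|^6 / |AA| of them, and it suffices to bound
   their number by O(n^(3/2)), n = |A + A| |A|^2, when n is small compared with p^2
   (otherwise |A + A| is so large that the claim follows from |A| < p^(3/5)).

   Each collision is an intersection of two lines of K^3 with directions
   (1, s, s^2), K = F(T), taken from two families of n lines that are skew within
   each family.  Let Q of degree O(n^(1/2)) vanish on all these lines.  At a point
   where two of them cross, their slopes are the two roots s1, s2 of
   Q_X + Q_Y s + Q_Z s^2.  If every line is crossed more often than a multiple of
   deg Q, then the second derivative of Q in the direction of the second root
   vanishes along every line, and differentiating this along the crossing lines
   gives (1 / (s1 - s2))'' = 0 along a line on which Q is nonsingular.  Since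
   deg Q is small compared with p, 1 / (s1 - s2) is then a linear function on that
   line, so the lines crossing it lie in one regulus, which contains at most |A| of
   them.  Hence some line is crossed O(n^(1/2)) times, and one removes lines one by
   one. *)
Require Import Defs.
From HB Require Import structures.
From mathcomp Require Import all_boot all_order all_algebra finmap.
From mathcomp Require Import reals exp.
From mathcomp Require Import mpoly ring zify.

Set Implicit Arguments.
Unset Strict Implicit.
Unset Printing Implicit Defensive.

Import Order.TTheory GRing.Theory Num.Theory.
Local Open Scope ring_scope.

(** * Jets at a crossing of two directions *)

Section Pointwise.
Variable K : fieldType.
Implicit Types s : K.

(** Vieta: the difference of the two equations is divisible by [s2 - s1]. *)
Lemma other_root s1 s2 qx qy qz :
  s1 != s2 ->
  qx + s1 * qy + s1 ^+ 2 * qz = 0 -> qx + s2 * qy + s2 ^+ 2 * qz = 0 ->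
  qy = - (s1 + s2) * qz.
Proof.
move=> s12 e1 e2.
have : (s2 - s1) * (qy + (s1 + s2) * qz) = 0.
  have -> : (s2 - s1) * (qy + (s1 + s2) * qz) =
    (qx + s2 * qy + s2 ^+ 2 * qz) - (qx + s1 * qy + s1 ^+ 2 * qz) by ring.
  by rewrite e1 e2 subr0.
by move/eqP; rewrite mulf_eq0 subr_eq0 eq_sym (negPf s12) /= addr_eq0 mulNr => /eqP.
Qed.

(* [q...] is a third order jet vanishing to order 3 in the direction s1 and to
   order 2 in the direction s2, where directions are (1, s, s^2).  The long
   hypothesis is the derivative in the direction s2 of [contact_form] below; up
   to factors s2 - s1 and qz it equals the conclusion, which reads (f/g)'' = 0
   for f = Q_Z and g = Q_Y + 2 s1 Q_Z along s1. *)
Lemma ratio_deriv2_jet s1 s2 qx qy qz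
    qxx qxy qxz qyy qyz qzz
    qxxx qxxy qxxz qxyy qxyz qxzz qyyy qyyz qyzz qzzz :
  let D s a b c := a + s * b + s ^+ 2 * c in
  let D2 s := D s (D s qxx qxy qxz) (D s qxy qyy qyz) (D s qxz qyz qzz) in
  let dxx := D s2 qxxx qxxy qxxz in let dxy := D s2 qxxy qxyy qxyz in
  let dxz := D s2 qxxz qxyz qxzz in let dyy := D s2 qxyy qyyy qyyz in
  let dyz := D s2 qxyz qyyz qyzz in let dzz := D s2 qxzz qyzz qzzz in
  let n := - (qy + s2 * qz) in
  let dz := D s2 qxz qyz qzz in
  let dn := - (D s2 qxy qyy qyz + s2 * dz) in
  let f' := D s1 qxz qyz qzz in
  let f'' := D s1 (D s1 qxxz qxyz qxzz) (D s1 qxyz qyyz qyzz) (D s1 qxzz qyzz qzzz) in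
  let g := qy + 2 * s1 * qz in
  let g' := D s1 qxy qyy qyz + 2 * s1 * f' in
  let g'' := D s1 (D s1 qxxy qxyy qxyz) (D s1 qxyy qyyy qyyz) (D s1 qxyz qyyz qyzz)
     + 2 * s1 * f'' in
  s1 != s2 ->
  D s1 qx qy qz = 0 -> D s2 qx qy qz = 0 ->
  D2 s1 = 0 -> D2 s2 = 0 ->
  D s1 (D s1 (D s1 qxxx qxxy qxxz) (D s1 qxxy qxyy qxyz) (D s1 qxxz qxyz qxzz))
       (D s1 (D s1 qxxy qxyy qxyz) (D s1 qxyy qyyy qyyz) (D s1 qxyz qyyz qyzz))
       (D s1 (D s1 qxxz qxyz qxzz) (D s1 qxyz qyyz qyzz) (D s1 qxzz qyzz qzzz)) = 0 ->
  dxx * qz ^+ 4 + qxx * (4 * dz * qz ^+ 3)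
  + 2 * (dxy * n * qz ^+ 3 + qxy * (dn * qz ^+ 3 + n * (3 * dz * qz ^+ 2)))
  + ((dyy + 2 * dxz) * n ^+ 2 * qz ^+ 2
     + (qyy + 2 * qxz) * (2 * dn * n * qz ^+ 2 + n ^+ 2 * (2 * dz * qz)))
  + 2 * (dyz * n ^+ 3 * qz + qyz * (3 * dn * n ^+ 2 * qz + n ^+ 3 * dz))
  + (dzz * n ^+ 4 + qzz * (4 * dn * n ^+ 3)) = 0 ->
  (f'' * g - qz * g'') * g - 2 * (f' * g - qz * g') * g' = 0.
Proof.
move=> D D2 dxx dxy dxz dyy dyz dzz n dz dn f' f'' g g' g'' s12 h1 h2 h11 h22 h111 hF.
have eqy := other_root s12 h1 h2.
have [qz0|qz0] := eqVneq qz 0.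
  by rewrite /g eqy qz0; ring.
have en : n = s1 * qz by rewrite /n eqy; ring.
have eg : g = - (s2 - s1) * qz by rewrite /g eqy; ring.
have eT : (f'' * g - qz * g'') * g - 2 * (f' * g - qz * g') * g'
  = qz * (qz * ((s2 - s1) * g'' + (s2 - s1) ^+ 2 * f'') + 2 * (g' + (s2 - s1) * f') * g').
  by rewrite eg; ring.
rewrite {}eT; move: hF; rewrite {}en => hF; clear eg g.
apply: (@mulfI _ ((s2 - s1) * qz ^+ 2)).
  by rewrite mulf_neq0 ?expf_neq0 // subr_eq0 eq_sym.
rewrite mulr0 -[RHS](mulr0 (s2 - s1)) -[in RHS]hF.
set h := (X in X = 0) in h111.
(* Up to nonzero factors, the hypothesis [hF] is the wanted expression plus multiples of the
   vanishing [h], [D2 s1] and [D2 s2]. *)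
transitivity ((s2 - s1) * qz ^+ 2 * (qz * (qz * ((s2 - s1) * g'' + (s2 - s1) ^+ 2 * f'') + 2 * (g' + (s2 - s1) * f') * g'))
  + qz ^+ 4 * (s2 - s1) * h + 2 * qz ^+ 3 * (D2 s1 - D2 s2) * g' + 4 * (s2 - s1) * qz ^+ 3 * dz * D2 s1).
  by rewrite h111 h11 h22; ring.
rewrite /h /g'' /f'' /g' /f' /dn /dz /dxx /dxy /dxz /dyy /dyz /dzz /D2 /D.
by ring.
Qed.
End Pointwise.

(** * Univariate polynomials of degree small against the characteristic *)

Section Univariate.
Variables (K : fieldType) (m : nat).
Hypothesis char_ge : forall n, (0 < n < m)%N -> n%:R != 0 :> K.
Implicit Types f g : {poly K}.

Lemma size_deriv_eq0 f : (size f <= m)%N -> f^`() = 0 -> (size f <= 1)%N.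
Proof.
move=> fm f'0; apply/leq_sizeP => -[//|j] _.
have [jm|mj] := ltnP j.+1 m; last by apply: nth_default; apply: leq_trans mj.
have /polyP/(_ j) := f'0; rewrite coef_deriv coef0 -mulr_natr => /eqP.
by rewrite mulf_eq0 (negPf (char_ge _)) //= orbF => /eqP.
Qed.

(** The derivative is shorter than [f], so divisibility makes it zero. *)
Lemma dvdp_deriv_size f : (size f <= m)%N -> f %| f^`() -> (size f <= 1)%N.
Proof.
move=> fm fd; apply: size_deriv_eq0 => //; apply/eqP; apply: contraLR fd => f'0.
apply: contraNN f'0 => fd; have [->|f0] := eqVneq f 0; first by rewrite deriv0.
by apply: contraLR (lt_size_deriv f0) => f'0; rewrite -leqNgt dvdp_leq.
Qed.

(** After division by the gcd, coprimality makes each cofactor divide its own derivative, so both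
    are constant. *)
Lemma wronskian_eq0 f g : g != 0 -> (size f <= m)%N -> (size g <= m)%N ->
  f^`() * g = f * g^`() -> exists c, f = c *: g.
Proof.
move=> g0 fm gm W; set h := gcdp f g.
have h0 : h != 0 by rewrite gcdp_eq0 (negPf g0) andbF.
have fE : f = f %/ h * h by rewrite divpK ?dvdp_gcdl.
have gE : g = g %/ h * h by rewrite divpK ?dvdp_gcdr.
have cop : coprimep (f %/ h) (g %/ h) by rewrite coprimep_div_gcd // g0 orbT.
move: (f %/ h) (g %/ h) fE gE cop => f1 g1 fE gE cop.
have W1 : f1^`() * g1 = f1 * g1^`().
  apply: (mulIf (mulf_neq0 h0 h0)).
  have -> : f1^`() * g1 * (h * h) = f^`() * g - f1 * g1 * h * h^`().
    by rewrite fE gE derivM; ring.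
  by rewrite W {1}fE {1}gE derivM; ring.
have g10 : g1 != 0 by apply: contraNneq g0 => g10; rewrite gE g10 mul0r.
have g1m : (size g1 <= m)%N by apply: leq_trans gm; rewrite dvdp_leq // gE dvdp_mulr.
have g1c : (size g1 <= 1)%N.
  apply: dvdp_deriv_size => //.
  by rewrite -(Gauss_dvdpr _ (_ : coprimep g1 f1)) 1?coprimep_sym // -W1 dvdp_mull.
have f1c : (size f1 <= 1)%N.
  have [->|f10] := eqVneq f1 0; first by rewrite size_poly0.
  apply: dvdp_deriv_size; last first.
    by rewrite -(Gauss_dvdpl _ cop) W1 dvdp_mulr.
  apply: leq_trans fm; apply: dvdp_leq; last by rewrite fE dvdp_mulr.
  by rewrite fE mulf_neq0.
move: g10; rewrite fE gE (size1_polyC g1c) (size1_polyC f1c) polyC_eq0 => g10.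
by exists (f1`_0 / g1`_0); rewrite !mul_polyC scalerA divfK.
Qed.

(* The equation says (f/g)'' = 0; it is read as N/g^2 being constant for the
   Wronskian N, then as (f - c X g)/g being constant. *)
Lemma linear_ratio f g d : g != 0 -> (size f <= d)%N -> (size g <= d)%N -> (d.*2 <= m)%N ->
  (f^`()^`() * g - f * g^`()^`()) * g - 2 * (f^`() * g - f * g^`()) * g^`() = 0 ->
  exists c0 c1, f = (c0%:P + c1 *: 'X) * g.
Proof.
move=> g0 fd gd dm ode.
have d0 : (0 < d)%N by rewrite (leq_trans _ gd) // size_poly_gt0.
set N := f^`() * g - f * g^`().
have N' : N^`() = f^`()^`() * g - f * g^`()^`() by rewrite /N derivB !derivM; ring.
have sz' (q : {poly K}) : (size q <= d -> size q^`() <= d)%N.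
  have [->|q0] := eqVneq q 0; first by rewrite deriv0.
  by move=> qd; rewrite ltnW // (leq_trans (lt_size_deriv q0)).
have szM (q r : {poly K}) : (size q <= d)%N -> (size r <= d)%N -> (size (q * r)%R <= m)%N.
  by move=> qd rd; rewrite (leq_trans (size_polyMleq _ _)) //; lia.
have [||||c Nc] := @wronskian_eq0 N (g * g).
- by rewrite mulf_neq0.
- rewrite (leq_trans (size_polyD _ _)) // geq_max size_polyN !szM ?sz' //.
- exact: szM.
- apply/eqP; rewrite -subr_eq0 N' derivM; apply/eqP.
  by rewrite -[RHS](mulr0 g) -ode /N; ring.
have [|||c0 fE] := @wronskian_eq0 (f - c *: 'X * g) g g0.
- rewrite (leq_trans (size_polyD _ _)) // geq_max size_polyN; apply/andP; split.
    by rewrite (leq_trans fd) // (leq_trans _ dm) // -addnn leq_addr.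
  rewrite -scalerAl (leq_trans (size_scale_leq _ _)) // (leq_trans (size_polyMleq _ _)) //.
  have gd1 : ((size g).+1 <= d + d)%N by rewrite -addn1 leq_add.
  by rewrite size_polyX (leq_trans gd1) // addnn.
- by rewrite (leq_trans gd) //; lia.
- have -> : (f - c *: 'X * g)^`() = f^`() - c *: g - c *: ('X * g^`()).
    by rewrite derivB -scalerAl derivZ derivM derivX mul1r scalerDr; ring.
  have /eqP := Nc; rewrite /N subr_eq => /eqP E.
  by rewrite !mulrBl E -!mul_polyC; ring.
by exists c0, c; rewrite mulrDl mul_polyC -fE; ring.
Qed.
End Univariate.

(** * Linear relations, and restriction of polynomials to curves *)

Lemma nontrivial_relation (K : fieldType) (I J : finType) (A : I -> J -> K) :
  (#|J| < #|I|)%N ->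
  exists2 c : I -> K, exists i, c i != 0 & forall j, \sum_i c i * A i j = 0.
Proof.
move=> JI; pose M := \matrix_(i < #|I|, j < #|J|) A (enum_val i) (enum_val j).
have /rowV0Pn[v /sub_kermxP vM v0] : kermx M != 0.
  rewrite -mxrank_eq0 mxrank_ker subn_eq0 -ltnNge.
  exact: leq_ltn_trans (rank_leq_col _) JI.
have [i vi] : exists i, v 0 i != 0.
  apply/existsP; apply: contraNT v0; rewrite negb_exists => /forallP v0.
  by apply/eqP/rowP => i; rewrite mxE; apply/eqP; have := v0 i; rewrite negbK.
exists (fun i => v 0 (enum_rank i)); first by exists (enum_val i); rewrite enum_valK.
move=> j; transitivity ((v *m M) 0 (enum_rank j)); last by rewrite vM mxE.
rewrite mxE (reindex_onto enum_val enum_rank) => [|i' _]; last exact: enum_rankK.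
apply: eq_big => [k|k _]; first by rewrite enum_valK eqxx.
by rewrite !mxE enum_valK enum_rankK.
Qed.

Section Mpoly.
Variables (n : nat) (K : fieldType).
Implicit Types (P Q : {mpoly K[n]}) (h : 'I_n -> {poly K}).

Definition restrict h P : {poly K} := mmap (@polyC K) h P.

HB.instance Definition _ h := GRing.RMorphism.copy (restrict h) (mmap (@polyC K) h).

Lemma restrictC h c : restrict h c%:MP = c%:P.
Proof. exact: mmapC. Qed.

Lemma restrictZ h c P : restrict h (c *: P) = c *: restrict h P.
Proof. by rewrite /restrict mmapZ mul_polyC. Qed.

Lemma restrictU h i : restrict h 'X_i = h i.
Proof. by rewrite /restrict mmapX mmap1U. Qed.

(** The chain rule. Both sides are linear and obey the Leibniz rule, so constants and variables
    suffice. *)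
Lemma deriv_restrict h P :
  (restrict h P)^`() = \sum_i restrict h P^`M(i) * (h i)^`().
Proof.
pose C P := (restrict h P)^`() = \sum_i restrict h P^`M(i) * (h i)^`().
have CM P1 P2 : C P1 -> C P2 -> C (P1 * P2).
  rewrite /C => h1 h2; rewrite rmorphM derivM h1 h2 mulr_suml mulr_sumr -big_split.
  apply: eq_bigr => i _ /=; rewrite mderivM rmorphD !rmorphM /=; ring.
have C1 : C 1.
  by rewrite /C rmorph1 derivC big1 // => i _; rewrite -mpolyC1 mderivC rmorph0 mul0r.
have CU i : C 'X_i.
  rewrite /C restrictU (bigD1 i) //= big1 => [|j ji].
    have UU : (U_(i) - U_(i) = 0 :> 'X_{1..n})%MM by apply/mnmP => k; rewrite mnmBE subnn mnmE.
    by rewrite mderivX mnm1E eqxx scale1r UU mpolyX0 rmorph1 mul1r addr0.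
  by rewrite mderivX mnm1E eq_sym (negPf ji) scale0r rmorph0 mul0r.
elim/mpolyind: P => [|c mm P _ _ IH].
  by rewrite rmorph0 deriv0 big1 // => i _; rewrite mderiv0 rmorph0 mul0r.
have CX : C 'X_[mm].
  rewrite mpolyXE_id; elim/big_ind: _ => // i _.
  by elim: (mm i) => [|k IHk]; rewrite ?expr0 // exprS; apply: CM.
rewrite rmorphD /= derivD IH restrictZ derivZ CX scaler_sumr -big_split /=.
apply: eq_bigr => i _; rewrite mderivD mderivZ rmorphD /= restrictZ mulrDl.
by rewrite -scalerAl.
Qed.

Lemma horner_restrict h P t :
  (restrict h P).[t] = P.@[fun i => (h i).[t]].
Proof.
rewrite mevalE /restrict /mmap horner_sum; apply: eq_bigr => mm _.
rewrite hornerM hornerC; congr (_ * _).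
by rewrite /mmap1 horner_prod; apply: eq_bigr => i _; rewrite horner_exp.
Qed.

Lemma size_mmap1 h mm : (forall i, size (h i) <= 2)%N ->
  (size (mmap1 h mm) <= (mdeg mm).+1)%N.
Proof.
move=> sh; rewrite /mmap1 mdegE.
elim/big_rec2: _ => [|i s q _ IH]; first by rewrite size_poly1.
rewrite (leq_trans (size_polyMleq _ _)) //.
have hk : ((size (h i)).-1 * mm i <= mm i)%N.
  by rewrite -[leqRHS]mul1n leq_mul2r -subn1 leq_subLR sh orbT.
have := leq_trans (size_poly_exp_leq (h i) (mm i)) (_ : _ < (mm i).+1)%N.
move=> /(_ hk) hi; have : (size (h i ^+ mm i)%R + size s <= (mm i).+1 + q.+1)%N by rewrite leq_add.
by rewrite addSn addnS; case: (_ + _)%N.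
Qed.

Lemma size_restrict h P : (forall i, size (h i) <= 2)%N ->
  (size (restrict h P) <= msize P)%N.
Proof.
move=> sh; rewrite /restrict /mmap (leq_trans (size_sum _ _ _)) //.
rewrite big_seq; elim/big_rec: _ => // mm s mP IH; rewrite geq_max IH andbT.
rewrite mul_polyC (leq_trans (size_scale_leq _ _)) // (leq_trans (size_mmap1 _ sh)) //.
exact: msize_mdeg_lt.
Qed.

Lemma msize_mderiv i P : (msize P^`M(i) <= (msize P).-1)%N.
Proof.
rewrite [msize P^`M(i)]msizeE big_seq; apply/bigmax_leqP_seq => mm _ mmP.
have : (mm + U_(i))%MM \in msupp P.
  rewrite mcoeff_msupp; move: mmP; rewrite mcoeff_msupp mcoeff_mderiv.
  by apply: contraNneq => ->; rewrite mul0rn.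
by move/msize_mdeg_lt; rewrite mdegD mdeg1; lia.
Qed.

End Mpoly.

Lemma poly_eq0_of_roots (K : fieldType) (V : finType) (U : {set V}) (t : V -> K)
    (f : {poly K}) :
  {in U &, injective t} -> {in U, forall u, f.[t u] = 0} -> (size f <= #|U|)%N ->
  f = 0.
Proof.
move=> ti tf; rewrite cardE -(size_map t).
apply: contraTeq => f0; rewrite -ltnNge max_poly_roots //.
  by apply/allP => _ /mapP[u + ->]; rewrite mem_enum => /tf/eqP.
by rewrite map_inj_in_uniq ?enum_uniq // => u v; rewrite !mem_enum; apply: ti.
Qed.

(** * The contact form and the second derivative of a ratio *)

Section Forms.
Variable K : fieldType.
Implicit Types (s t : K) (b c xx xy xz yy yz zz f g : {poly K}).

(* If xx, ..., zz are the second partial derivatives of Q and b, c those in y, z,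
   this is c^4 times the second derivative of Q in the direction (1, n/c, (n/c)^2),
   where n/c is the second root of the tangent quadratic Q_X + Q_Y s + Q_Z s^2. *)
Definition contact_form s b c xx xy xz yy yz zz :=
  let n := - (b + s *: c) in
  xx * c ^+ 4 + (xy * (n * c ^+ 3)) *+ 2 + (yy + xz *+ 2) * (n ^+ 2 * c ^+ 2)
  + (yz * (n ^+ 3 * c)) *+ 2 + zz * n ^+ 4.

(* g^3 (f/g)'' *)
Definition ratio_deriv2_form f g :=
  (f^`()^`() * g - f * g^`()^`()) * g - (f^`() * g - f * g^`()) * g^`() *+ 2.

Let hE := (hornerD, hornerN, hornerZ, hornerM, hornerMn, horner_exp).
Let dE := (derivD, derivN, derivM, derivZ, derivMn, deriv_exp).

Lemma horner_contact_form s b c xx xy xz yy yz zz t :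
  (contact_form s b c xx xy xz yy yz zz).[t] =
  let n := - (b.[t] + s * c.[t]) in
  xx.[t] * c.[t] ^+ 4 + 2 * (xy.[t] * n * c.[t] ^+ 3)
  + (yy.[t] + 2 * xz.[t]) * n ^+ 2 * c.[t] ^+ 2
  + 2 * (yz.[t] * n ^+ 3 * c.[t]) + zz.[t] * n ^+ 4.
Proof. by rewrite /contact_form !hE /=; ring. Qed.

Lemma deriv_contact_form s b c xx xy xz yy yz zz t :
  (contact_form s b c xx xy xz yy yz zz)^`().[t] =
  let n := - (b.[t] + s * c.[t]) in
  let dz := c^`().[t] in let dn := - (b^`().[t] + s * dz) in let qz := c.[t] in
  xx^`().[t] * qz ^+ 4 + xx.[t] * (4 * dz * qz ^+ 3)
  + 2 * (xy^`().[t] * n * qz ^+ 3 + xy.[t] * (dn * qz ^+ 3 + n * (3 * dz * qz ^+ 2)))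
  + ((yy^`().[t] + 2 * xz^`().[t]) * n ^+ 2 * qz ^+ 2
     + (yy.[t] + 2 * xz.[t]) * (2 * dn * n * qz ^+ 2 + n ^+ 2 * (2 * dz * qz)))
  + 2 * (yz^`().[t] * n ^+ 3 * qz + yz.[t] * (3 * dn * n ^+ 2 * qz + n ^+ 3 * dz))
  + (zz^`().[t] * n ^+ 4 + zz.[t] * (4 * dn * n ^+ 3)).
Proof. by rewrite /contact_form !dE !hE /=; ring. Qed.

Lemma horner_ratio_deriv2_form f g t :
  (ratio_deriv2_form f g).[t] =
  (f^`()^`().[t] * g.[t] - f.[t] * g^`()^`().[t]) * g.[t]
   - 2 * (f^`().[t] * g.[t] - f.[t] * g^`().[t]) * g^`().[t].
Proof. by rewrite /ratio_deriv2_form !hE; ring. Qed.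

Let szM f g i j : (size f <= i.+1)%N -> (size g <= j.+1)%N -> (size (f * g)%R <= (i + j).+1)%N.
Proof.
move=> fi gj; rewrite (leq_trans (size_polyMleq _ _)) // -ltnS.
by case: (size f) fi => [|a] fi; case: (size g) gj => [|b] gj; lia.
Qed.

Let szX f i k : (size f <= i.+1)%N -> (size (f ^+ k)%R <= (i * k).+1)%N.
Proof.
move=> fi; elim: k => [|k IH]; first by rewrite expr0 size_poly1.
by rewrite exprS mulnS szM.
Qed.

Let szD f g i : (size f <= i)%N -> (size g <= i)%N -> (size (f + g)%R <= i)%N.
Proof. by move=> fi gi; rewrite (leq_trans (size_polyD _ _)) // geq_max fi. Qed.

Let szMn f k i : (size f <= i)%N -> (size (f *+ k) <= i)%N.
Proof. by move=> fi; rewrite -scaler_nat (leq_trans (size_scale_leq _ _)). Qed.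

(** Each summand is a product of five factors: one second derivative and four among [c] and
    [- (b + s *: c)]. *)
Lemma size_contact_form s b c xx xy xz yy yz zz n :
  all (fun f : {poly K} => size f <= n.+1)%N [:: b; c; xx; xy; xz; yy; yz; zz] ->
  (size (contact_form s b c xx xy xz yy yz zz) <= (5 * n).+1)%N.
Proof.
case/and5P => hb hc hxx hxy /and5P[hxz hyy hyz hzz _].
rewrite /contact_form /=; set o := - (b + s *: c).
have ho : (size o <= n.+1)%N.
  by rewrite size_polyN szD // (leq_trans (size_scale_leq _ _)).
have le5 f a : (size f <= a.+1)%N -> a = (5 * n)%N -> (size f <= (5 * n).+1)%N by move=> ? <-.
apply: (szD (szD (szD (szD _ (szMn 2 _)) _) (szMn 2 _)) _).
- by apply: le5 (szM hxx (szX 4 hc)) _; lia.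
- by apply: le5 (szM hxy (szM ho (szX 3 hc))) _; lia.
- by apply: le5 (szM (szD hyy (szMn 2 hxz)) (szM (szX 2 ho) (szX 2 hc))) _; lia.
- by apply: le5 (szM hyz (szM (szX 3 ho) hc)) _; lia.
- by apply: le5 (szM hzz (szX 4 ho)) _; lia.
Qed.

Lemma size_ratio_deriv2_form f g n : (size f <= n.+1)%N -> (size g <= n.+1)%N ->
  (size (ratio_deriv2_form f g) <= (3 * n).+1)%N.
Proof.
have szd (h : {poly K}) : (size h <= n.+1)%N -> (size h^`() <= n.+1)%N.
  have [->|h0] := eqVneq h 0; first by rewrite deriv0.
  by move=> hn; rewrite ltnW // (leq_trans (lt_size_deriv h0)).
have szN (h : {poly K}) i : (size h <= i)%N -> (size (- h) <= i)%N by rewrite size_polyN.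
have -> : (3 * n = n + n + n)%N by lia.
move=> fn gn; have [f1 g1] := (szd _ fn, szd _ gn).
have [f2 g2] := (szd _ f1, szd _ g1).
apply: szD; [|apply/szN/szMn]; apply: szM => //; apply: szD; rewrite ?szN //; exact: szM.
Qed.
End Forms.

(** * Rays, and the jets of a surface where two of its rays cross *)

Definition oX : 'I_3 := @Ordinal 3 0 isT.
Definition oY : 'I_3 := @Ordinal 3 1 isT.
Definition oZ : 'I_3 := @Ordinal 3 2 isT.

(* The line X = t, Y = y + s t, Z = z + s^2 t with z = w + s y; the coordinate w
   makes the condition [meet] that two rays intersect bilinear. *)
Definition ray (K : fieldType) (s y w : K) (i : 'I_3) : {poly K} :=
  tnth [tuple 'X; y%:P + s *: 'X; (w + s * y)%:P + s ^+ 2 *: 'X] i.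

(* Locked, since unification of restrictions to different rays by unfolding
   does not terminate in reasonable time. *)
HB.lock Definition along (K : fieldType) (s y w : K) (P : {mpoly K[3]}) :=
  restrict (ray s y w) P.

Section Rays.
Variables (K : fieldType) (V : finType) (s y w : V -> K).

(* For s v = s u this is coplanarity with a tangent plane of the cone, not
   intersection. *)
Definition meet v u := w v - w u == s u * y v - s v * y u.

(* The X-coordinate of the intersection point; 0 for parallel rays. *)
Definition crossing v u := (y u - y v) / (s v - s u).

Local Notation r v P := (along (s v) (y v) (w v) P).
Local Notation ray_of v := (ray (s v) (y v) (w v)).

Lemma deriv_along v P :
  (r v P)^`() = r v P^`M(oX) + s v *: r v P^`M(oY) + s v ^+ 2 *: r v P^`M(oZ).
Proof.
have rE : (ray_of v oX)^`() = 1 /\ (ray_of v oY)^`() = (s v)%:P /\ (ray_of v oZ)^`() = (s v ^+ 2)%:P.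
  by rewrite /ray !(tnth_nth 0) /= !derivE !add0r -!mul_polyC !mulr1.
have [e0 e1 e2] : [/\ ord0 = oX, lift ord0 ord0 = oY & lift ord0 (lift ord0 ord0) = oZ].
  by split; apply: val_inj.
rewrite along.unlock deriv_restrict !big_ord_recl big_ord0 addr0 e2 e1 e0.
case: rE => -> [-> ->]; rewrite -!mul_polyC; ring.
Qed.

(** Both rays pass through one point there: X is the parameter of both, [crossing] equates the
    Y-coordinates and [meet] then the Z-coordinates. *)
Lemma horner_crossing v u P : s v != s u -> meet v u ->
  (r u P).[crossing v u] = (r v P).[crossing v u].
Proof.
move=> svu /eqP vu; rewrite along.unlock !horner_restrict; apply: meval_eq.
have svu0 : s v - s u != 0 by rewrite subr_eq0.
have E1 : y u + s u * crossing v u = y v + s v * crossing v u.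
  by rewrite /crossing; field.
have E2 : w u + s u * y u + s u ^+ 2 * crossing v u = w v + s v * y v + s v ^+ 2 * crossing v u.
  have -> : w u = w v - (s u * y v - s v * y u) by rewrite -vu; ring.
  by rewrite /crossing; field.
move: (crossing v u) E1 E2 => t E1 E2.
by case=> -[|[|[|//]]] i; rewrite /ray !(tnth_nth 0) /= ?hornerE.
Qed.

(** Rays through a common point of [v] meet; when neighbours are skew, crossing points on [v] are
    therefore distinct. *)
Lemma meet_of_crossing v u u' : s v != s u -> s v != s u' -> meet v u -> meet v u' ->
  crossing v u = crossing v u' -> meet u u'.
Proof.
move=> vu vu' /eqP mu /eqP mu' c.
have yE x : s v != s x -> y x = y v + (s v - s x) * crossing v x.
  by rewrite -subr_eq0 => vx; rewrite /crossing; field.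
apply/eqP; have -> : w u - w u' = (w v - w u') - (w v - w u) by ring.
by rewrite mu mu' (yE u) // (yE u') // c; ring.
Qed.

(** Sorts the indices of iterated partial derivatives in the order X, Y, Z. *)
Let comm := ((fun P : {mpoly K[3]} => mderiv_comm oY oX P),
  (fun P : {mpoly K[3]} => mderiv_comm oZ oX P),
  (fun P : {mpoly K[3]} => mderiv_comm oZ oY P)).

Definition dir v (a b c : {poly K}) := a + s v *: b + s v ^+ 2 *: c.

Lemma horner_dir v a b c t :
  (dir v a b c).[t] = a.[t] + s v * b.[t] + s v ^+ 2 * c.[t].
Proof. by rewrite /dir !hornerD !hornerZ. Qed.

Section Jets.
Variable Q : {mpoly K[3]}.
Local Notation d1 v i := (r v Q^`M(i)).
Local Notation d2 v i j := (r v Q^`M(i)^`M(j)).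
Local Notation d3 v i j k := (r v Q^`M(i)^`M(j)^`M(k)).

Lemma deriv_d1 v i : (d1 v i)^`() = dir v (d2 v i oX) (d2 v i oY) (d2 v i oZ).
Proof. exact: deriv_along. Qed.

Lemma deriv_d2 v i j : (d2 v i j)^`() = dir v (d3 v i j oX) (d3 v i j oY) (d3 v i j oZ).
Proof. exact: deriv_along. Qed.

Lemma jet1 v : r v Q = 0 -> dir v (d1 v oX) (d1 v oY) (d1 v oZ) = 0.
Proof. by move=> Q0; rewrite /dir -deriv_along Q0 deriv0. Qed.

Lemma deriv_dir v a b c : (dir v a b c)^`() = dir v a^`() b^`() c^`().
Proof. by rewrite /dir !derivD !derivZ. Qed.

Lemma jet2 v : r v Q = 0 ->
  dir v (dir v (d2 v oX oX) (d2 v oX oY) (d2 v oX oZ))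
    (dir v (d2 v oX oY) (d2 v oY oY) (d2 v oY oZ))
    (dir v (d2 v oX oZ) (d2 v oY oZ) (d2 v oZ oZ)) = 0.
Proof.
move=> /jet1/(congr1 (@deriv _)); rewrite deriv0 => <-.
by rewrite deriv_dir !deriv_d1 !comm.
Qed.

Lemma jet3 v : r v Q = 0 ->
  dir v
   (dir v (dir v (d3 v oX oX oX) (d3 v oX oX oY) (d3 v oX oX oZ))
    (dir v (d3 v oX oX oY) (d3 v oX oY oY) (d3 v oX oY oZ))
    (dir v (d3 v oX oX oZ) (d3 v oX oY oZ) (d3 v oX oZ oZ)))
   (dir v (dir v (d3 v oX oX oY) (d3 v oX oY oY) (d3 v oX oY oZ))
    (dir v (d3 v oX oY oY) (d3 v oY oY oY) (d3 v oY oY oZ))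
    (dir v (d3 v oX oY oZ) (d3 v oY oY oZ) (d3 v oY oZ oZ)))
   (dir v (dir v (d3 v oX oX oZ) (d3 v oX oY oZ) (d3 v oX oZ oZ))
    (dir v (d3 v oX oY oZ) (d3 v oY oY oZ) (d3 v oY oZ oZ))
    (dir v (d3 v oX oZ oZ) (d3 v oY oZ oZ) (d3 v oZ oZ oZ))) = 0.
Proof.
move=> /jet2/(congr1 (@deriv _)); rewrite deriv0 => <-.
by rewrite !deriv_dir !deriv_d2 !comm.
Qed.

Definition contact v := contact_form (s v) (d1 v oY) (d1 v oZ)
  (d2 v oX oX) (d2 v oX oY) (d2 v oX oZ) (d2 v oY oY) (d2 v oY oZ) (d2 v oZ oZ).

(* Where the ray v crosses a ray u in the surface Q = 0, this is
   (s v - s u) Q_Z. *)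
Definition transverse v := d1 v oY + 2 * s v *: d1 v oZ.

Definition ratio_deriv2 v := ratio_deriv2_form (d1 v oZ) (transverse v).

Section Crossing.
Variables v u : V.
Hypotheses (vu : s v != s u) (mvu : meet v u) (rv : r v Q = 0) (ru : r u Q = 0).
Let t := crossing v u.

Let cross P : (r u P).[t] = (r v P).[t].
Proof. exact: horner_crossing. Qed.

Let at0 (f : {poly K}) : f = 0 -> f.[t] = 0.
Proof. by move->; rewrite horner0. Qed.

(** Both slopes are roots of the tangent quadratic at the crossing point. *)
Lemma d1_crossing :
  (d1 v oX).[t] = s v * s u * (d1 v oZ).[t] /\ (d1 v oY).[t] = - (s v + s u) * (d1 v oZ).[t].
Proof.
have := at0 (jet1 rv); have := at0 (jet1 ru).
rewrite !horner_dir !cross => h2 h1.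
have e := other_root vu h1 h2; split=> //.
by move/eqP: h1; rewrite -addrA addr_eq0 => /eqP ->; rewrite e; ring.
Qed.

(** The second root of the tangent quadratic is [s u], so the value is Q_Z^4 times the second
    derivative of Q along [u], which is zero. *)
Lemma contact_crossing : (contact v).[t] = 0.
Proof.
have [ex ey] := d1_crossing.
have h22 := at0 (jet2 ru); rewrite !horner_dir !cross in h22.
rewrite /contact horner_contact_form /= ey.
rewrite -[RHS](mulr0 ((d1 v oZ).[t] ^+ 4)) -h22; ring.
Qed.

(** Differentiate [contact u = 0] along [u], then read every partial derivative at the common point
    on [v]; this is the jet computation with [s1 = s v] and [s2 = s u]. *)
Lemma ratio_deriv2_crossing : contact u = 0 -> (ratio_deriv2 v).[t] = 0.
Proof.
move=> cu; have hF : (contact u)^`().[t] = 0 by rewrite cu deriv0 horner0.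
have h1 := at0 (jet1 rv); have h2 := at0 (jet1 ru).
have h11 := at0 (jet2 rv); have h22 := at0 (jet2 ru).
have h111 := at0 (jet3 rv).
rewrite !horner_dir in h1. rewrite !horner_dir !cross in h2.
rewrite !horner_dir in h11. rewrite !horner_dir !cross in h22.
rewrite !horner_dir in h111.
have e1 i : (d1 u i)^`().[t] =
    (d2 v i oX).[t] + s u * (d2 v i oY).[t] + s u ^+ 2 * (d2 v i oZ).[t].
  by rewrite deriv_d1 horner_dir !cross.
have e2 i j : (d2 u i j)^`().[t] =
    (d3 v i j oX).[t] + s u * (d3 v i j oY).[t] + s u ^+ 2 * (d3 v i j oZ).[t].
  by rewrite deriv_d2 horner_dir !cross.
rewrite /contact deriv_contact_form in hF.
rewrite 2!e1 6!e2 8!cross in hF.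
rewrite !comm in hF.
have := ratio_deriv2_jet vu h1 h2 h11 h22 h111 hF.
rewrite /ratio_deriv2 horner_ratio_deriv2_form.
have v1 i : (d1 v i)^`().[t] =
    (d2 v i oX).[t] + s v * (d2 v i oY).[t] + s v ^+ 2 * (d2 v i oZ).[t].
  by rewrite deriv_d1 horner_dir.
have v2 i j : (d2 v i j)^`().[t] =
    (d3 v i j oX).[t] + s v * (d3 v i j oY).[t] + s v ^+ 2 * (d3 v i j oZ).[t].
  by rewrite deriv_d2 horner_dir.
have v3 i : (d1 v i)^`()^`().[t] = (d2 v i oX)^`().[t] + s v * (d2 v i oY)^`().[t]
    + s v ^+ 2 * (d2 v i oZ)^`().[t].
  by rewrite deriv_d1 deriv_dir horner_dir.
have -> : (transverse v).[t] = (d1 v oY).[t] + 2 * s v * (d1 v oZ).[t].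
  by rewrite hornerD hornerZ.
have -> : (transverse v)^`().[t] = (d1 v oY)^`().[t] + 2 * s v * (d1 v oZ)^`().[t].
  by rewrite derivD derivZ hornerD hornerZ.
have -> : (transverse v)^`()^`().[t] = (d1 v oY)^`()^`().[t] + 2 * s v * (d1 v oZ)^`()^`().[t].
  by rewrite !derivD !derivZ hornerD hornerZ.
by rewrite !v3 !v2 !v1 !comm.
Qed.
End Crossing.
End Jets.
End Rays.

(** * The polynomial method: some ray is crossed few times *)

(** Parameter count: D^3 monomials with exponents below D, against 3D coefficients on each of the
    |V| curves. *)
Lemma exists_vanishing (K : fieldType) (V : finType) (h : V -> 'I_3 -> {poly K}) D :
  (forall v i, size (h v i) <= 2)%N -> (3 * #|V| < D ^ 2)%N ->
  exists Q : {mpoly K[3]},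
    [/\ Q != 0, (msize Q <= 3 * D)%N & forall v, restrict (h v) Q = 0].
Proof.
move=> sh VD; have D0 : (0 < D)%N by case: D VD.
pose mono (f : {ffun 'I_3 -> 'I_D}) : 'X_{1..3} := [multinom (f i : nat) | i < 3].
have mono_inj : injective mono.
  by move=> f g /mnmP fg; apply/ffunP => i; apply/val_inj; have := fg i; rewrite !mnmE.
have mono_deg f : (mdeg (mono f) < 3 * D)%N.
  rewrite mdegE !big_ord_recl big_ord0 !mnmE.
  by move: (f _) (f _) (f _) => [a ?] [b ?] [c ?] /=; lia.
pose A f (vl : V * 'I_(3 * D)) := (restrict (h vl.1) 'X_[mono f])`_vl.2.
have [|c [i ci] rel] := @nontrivial_relation K _ _ A.
  rewrite card_prod card_ffun !card_ord.
  by rewrite mulnCA mulnA [(D ^ 3)%N]expnSr ltn_pmul2r.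
pose Q : {mpoly K[3]} := \sum_f c f *: 'X_[mono f].
have coefQ mm : Q@_mm = \sum_f c f * (mono f == mm)%:R.
  by rewrite /Q raddf_sum; apply: eq_bigr => f _; rewrite /= mcoeffZ mcoeffX.
have Qdeg : (msize Q <= 3 * D)%N.
  rewrite msizeE big_seq; apply/bigmax_leqP_seq => mm _; rewrite mcoeff_msupp coefQ.
  case: (pickP (fun f => mono f == mm)) => [f /eqP <- _ //|none].
  by rewrite big1 ?eqxx // => f _; rewrite none mulr0.
exists Q; split=> //.
  apply: contraNneq ci => Q0; have := coefQ (mono i); rewrite Q0 mcoeff0 => /esym.
  rewrite (bigD1 i) //= eqxx mulr1 big1 ?addr0 => [->//|f fi].
  by rewrite (inj_eq mono_inj) (negPf fi) mulr0.
move=> v; apply/polyP => l; rewrite coef0.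
have [lD|lD] := ltnP l (3 * D); last first.
  by apply: nth_default; rewrite (leq_trans (size_restrict _ _)) // (leq_trans Qdeg).
rewrite -[RHS](rel (v, Ordinal lD)) /Q raddf_sum coef_sum; apply: eq_bigr => f _.
by rewrite /= restrictZ coefZ.
Qed.

(* Replace Q by a derivative as long as all first derivatives vanish on the
   curves. *)
Lemma exists_nonsingular (n : nat) (K : fieldType) (m : nat) (V : finType) (W : {set V})
    (h : V -> 'I_n -> {poly K}) (Q : {mpoly K[n]}) :
  (forall j, (0 < j < m)%N -> j%:R != 0 :> K) ->
  W != set0 -> Q != 0 -> (msize Q <= m)%N -> {in W, forall v, restrict (h v) Q = 0} ->
  exists P : {mpoly K[n]}, [/\ P != 0, (msize P <= msize Q)%N,
    {in W, forall v, restrict (h v) P = 0} &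
    exists2 v, v \in W & exists i, restrict (h v) P^`M(i) != 0].
Proof.
move=> ch /set0Pn[w wW]; move: {2}(msize Q) (leqnn (msize Q)) => d.
elim: d Q => [|d IH] Q Qd Q0 Qm QW.
  by move: Qd; rewrite leqn0 msize_poly_eq0 (negPf Q0).
case: (pickP (fun vi : V * 'I_n => (vi.1 \in W) && (restrict (h vi.1) Q^`M(vi.2) != 0))).
  by case=> v i /= /andP[vW vi]; exists Q; split=> //; exists v => //; exists i.
move=> none; have QW' i : {in W, forall v, restrict (h v) Q^`M(i) = 0}.
  by move=> v vW; have := none (v, i); rewrite /= vW /= => /negbFE/eqP.
case: (pickP (fun i => Q^`M(i) != 0)) => [i Qi|cst].
  have := msize_mderiv i Q; have : (0 < msize Q)%N by rewrite lt0n msize_poly_eq0.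
  move=> h0 h1; have [||P [P0 Pd PW Pe]] := IH _ _ Qi _ (QW' i); [lia|lia|].
  by exists P; split=> //; lia.
(* All exponents in Q are below [m], so vanishing partial derivatives force Q to be constant; it is
   zero on a curve, hence zero. *)
have Qc : Q = (Q@_0%MM)%:MP.
  apply/mpolyP => mm; rewrite mcoeffC; have [->|mm0] := eqVneq 0%MM mm; first by rewrite mulr1.
  rewrite mulr0; have [//|mmQ] := eqVneq Q@_mm 0.
  have [i mi] : exists i, mm i != 0%N.
    apply/existsP; apply: contraNT mm0; rewrite negb_exists => /forallP m0.
    by apply/eqP/mnmP => i; have := m0 i; rewrite negbK mnm0E => /eqP.
  have := negbFE (cst i) => /eqP /(congr1 (fun P => P@_(mm - U_(i))%MM)).
  have Umm : (mm - U_(i) + U_(i) = mm)%MM.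
    apply: submK; apply/mnm_lepP => j; rewrite mnmE; case: eqP => // <-.
    by rewrite lt0n.
  rewrite mcoeff_mderiv mcoeff0 Umm mnmBE mnm1E eqxx subn1 prednK ?lt0n //.
  rewrite -mulr_natr => /eqP; rewrite mulf_eq0 (negPf mmQ) (negPf (ch _ _)) //.
  rewrite lt0n mi (leq_trans _ Qm) //.
  have : mm \in msupp Q by rewrite mcoeff_msupp.
  by move=> /msize_mdeg_lt; apply: leq_ltn_trans; rewrite mdegE (bigD1 i) //= leq_addr.
have := QW w wW; rewrite Qc restrictC => /eqP; rewrite polyC_eq0 => /eqP c0.
by move: Q0; rewrite Qc c0 mpolyC0 eqxx.
Qed.

(* By minimality of degrees, a polynomial Q of degree < 3D vanishing on all rays
   can be taken with nonzero gradient on some ray v of W.  If every ray of W meets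
   more than 15D + k others, then contact and ratio_deriv2 vanish identically on
   the rays, having too many zeros, so 1 / (s v - s u) is a linear function of the
   crossing point; the neighbours of v then lie in a single regulus, up to those
   at singular points of Q. *)
Section LowDegree.
Variables (K : fieldType) (V : finType) (s y w : V -> K) (e : rel V) (m D k : nat).
Hypothesis char_ge : forall j, (0 < j < m)%N -> j%:R != 0 :> K.
Hypothesis D_large : (3 * #|V| < D ^ 2)%N.
Hypothesis D_small : (6 * D <= m)%N.
Hypothesis e_slope : forall v u, e v u -> s v != s u.
Hypothesis e_meet : forall v u, e v u -> meet s y w v u.
Hypothesis nbr_skew : forall v u u', e v u -> e v u' -> u != u' -> ~~ meet s y w u u'.
Hypothesis nbr_pencil : forall v (c0 c1 : K),
  (#|[set u | e v u & (c0 * (s v - s u) + c1 * (y u - y v) == 1)%R]| <= k)%N.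

Lemma size_ray v i : (size (ray (s v) (y v) (w v) i) <= 2)%N.
Proof.
have sz (a b : K) : (size (a%:P + b *: 'X)%R <= 2)%N.
  rewrite (leq_trans (size_polyD _ _)) // geq_max size_polyC (leq_trans (leq_b1 _)) //=.
  by rewrite (leq_trans (size_scale_leq _ _)) ?size_polyX.
by case: i => -[|[|[|//]]] i; rewrite /ray (tnth_nth 0) /= ?sz ?size_polyX.
Qed.

Lemma size_along v P : (size (along (s v) (y v) (w v) P) <= msize P)%N.
Proof. by rewrite along.unlock size_restrict // => i; apply: size_ray. Qed.

Lemma exists_low_degree (W : {set V}) : W != set0 ->
  exists2 v, v \in W & (#|[set u in W | e v u]| <= 15 * D + k)%N.
Proof.
move=> W0.
have [Q0 [Q0n Q0d Q0V]] :=
  exists_vanishing (h := fun v => ray (s v) (y v) (w v)) size_ray D_large.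
have [|Q [Qn Qd QW [v vW [i Qi]]]] := exists_nonsingular char_ge W0 Q0n _ (in1W Q0V).
  by rewrite (leq_trans Q0d) //; lia.
have {}QW : {in W, forall v, along (s v) (y v) (w v) Q = 0}.
  by move=> u uW; rewrite along.unlock QW.
have {}Qi : along (s v) (y v) (w v) Q^`M(i) != 0 by rewrite along.unlock.
have {Q0 Q0n Q0d Q0V Qd} Qd := leq_trans Qd Q0d.
pose U v := [set u in W | e v u].
apply/exists_inP; apply: contraT => /exists_inPn big.
have {}big u : u \in W -> (15 * D + k < #|U u|)%N by move=> /big; rewrite -ltnNge.
exfalso.
have inj u : {in U u &, injective (crossing s y u)}.
  move=> x x'; rewrite !inE => /andP[_ ux] /andP[_ ux'] xx'.
  apply/eqP; apply: contraT => /(nbr_skew ux ux')/negP[].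
  by apply: meet_of_crossing xx'; rewrite ?e_slope ?e_meet.
have N0 : (0 < msize Q)%N by rewrite lt0n msize_poly_eq0.
pose n := (msize Q).-1.
have nE : msize Q = n.+1 by rewrite /n prednK.
have sz1 u j : (size (along (s u) (y u) (w u) Q^`M(j)) <= n.+1)%N.
  by rewrite (leq_trans (size_along _ _)) // (leq_trans (msize_mderiv _ _)) // nE leqW.
have sz2 u j l : (size (along (s u) (y u) (w u) Q^`M(j)^`M(l)) <= n.+1)%N.
  rewrite (leq_trans (size_along _ _)) // (leq_trans (msize_mderiv _ _)) //.
  by have := msize_mderiv j Q; rewrite nE; lia.
(* The degree is at most 5n with n < 3D, below the more than 15D crossing points. *)
have contact0 u : u \in W -> contact s y w Q u = 0.
  move=> uW; apply: (poly_eq0_of_roots (inj u)) => [x|].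
    rewrite inE => /andP[xW ux].
    by rewrite contact_crossing ?e_slope ?e_meet ?QW.
  rewrite (leq_trans (@size_contact_form _ _ _ _ _ _ _ _ _ _ n _)) //.
    by rewrite /= !sz1 !sz2.
  by have := big u uW; lia.
have szg : (size (transverse s y w Q v) <= n.+1)%N.
  rewrite (leq_trans (size_polyD _ _)) // geq_max sz1.
  by rewrite (leq_trans (size_scale_leq _ _)) ?sz1.
have ric0 : ratio_deriv2 s y w Q v = 0.
  apply: (poly_eq0_of_roots (inj v)) => [x|].
    rewrite inE => /andP[xW vx].
    by rewrite (@ratio_deriv2_crossing _ _ _ _ _ _ _ x) ?e_slope ?e_meet ?QW ?contact0.
  rewrite (leq_trans (@size_ratio_deriv2_form _ _ _ n _ _)) // ?sz1 //.
  by have := big v vW; lia.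
set f := along (s v) (y v) (w v) Q^`M(oZ).
set g := transverse s y w Q v in szg.
have gE x : x \in U v -> g.[crossing s y v x] = (s v - s x) * f.[crossing s y v x].
  rewrite inE => /andP[xW vx].
  have [_ h] := d1_crossing (e_slope vx) (e_meet vx) (QW _ vW) (QW _ xW).
  by rewrite /g /transverse hornerD hornerZ h /f; ring.
(* Otherwise Q_Z, and with it every first derivative of Q, vanishes at all crossings on [v] and
   hence along [v], against its choice. *)
have g0 : g != 0.
  apply: contraNneq Qi => gz; apply/eqP/(poly_eq0_of_roots (inj v)) => [x xU|]; last first.
    by rewrite (leq_trans (sz1 _ _)) //; have := big v vW; lia.
  have := gE x xU; rewrite gz horner0 => /esym/eqP; move: xU; rewrite inE => /andP[xW vx].
  rewrite mulf_eq0 subr_eq0 (negPf (e_slope vx)) /= => /eqP fz.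
  have [h0 h1] := d1_crossing (e_slope vx) (e_meet vx) (QW _ vW) (QW _ xW).
  rewrite -/f fz !mulr0 in h0 h1.
  case: i => -[|[|[|//]]] lt_i.
  - by rewrite (_ : Ordinal lt_i = oX) //; apply: val_inj.
  - by rewrite (_ : Ordinal lt_i = oY) //; apply: val_inj.
  - by rewrite (_ : Ordinal lt_i = oZ) //; apply: val_inj.
(* The bound 6D <= m is needed here: both sizes are at most 3D, and their double must not exceed
   [m]. *)
have [c0 [c1 fE]] : exists c0 c1, f = (c0%:P + c1 *: 'X) * g.
  apply: (linear_ratio char_ge g0 (sz1 v oZ) szg); first by lia.
  by rewrite -[RHS]ric0 /ratio_deriv2 /ratio_deriv2_form -/f -/g -mulrA mulr_natl.
pose B := [set u in U v | g.[crossing s y v u] == 0].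
have Bn : (#|B| <= n)%N.
  rewrite leqNgt; apply: contraNN g0 => nB; apply/eqP.
  apply: (@poly_eq0_of_roots _ _ B (crossing s y v)) => [x x'|x|].
  - by rewrite !inE -!andbA => /and3P[xW vx _] /and3P[x'W vx' _]; apply: inj; rewrite inE ?xW ?x'W.
  - by rewrite inE => /andP[_ /eqP].
  - exact: leq_trans szg _.
(* Off the zeros of g, cancelling g between [fE] and [gE] leaves 1 = (s v - s x) (c0 + c1 t) at the
   crossing parameter t. *)
have UB : U v \subset B :|: [set u | e v u & (c0 * (s v - s u) + c1 * (y u - y v) == 1)%R].
  apply/subsetP => x xU; rewrite !inE; move: (xU); rewrite inE => /andP[xW vx].
  rewrite xW vx /=; have [//|gx] := eqVneq g.[_] 0; rewrite /=.
  have sx : s v - s x != 0 by rewrite subr_eq0 e_slope.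
  move: gx (gE x xU); rewrite fE hornerM; set gx := g.[_] => gx0.
  rewrite mulrA -{1}[gx]mul1r => /(mulIf gx0) ->.
  have <- : (s v - s x) * crossing s y v x = y x - y v by rewrite /crossing; field.
  by rewrite hornerD hornerC hornerZ hornerX; apply/eqP; ring.
have := leq_trans (subset_leq_card UB) (leq_trans (leq_card_setU _ _) (leq_add Bn (nbr_pencil v c0 c1))).
by have := big v vW; lia.
Qed.

End LowDegree.

(** * Counting edges and collisions *)

(** Removing a vertex of degree at most [d] lowers the degree sum by at most 2d. *)
Lemma sum_degrees_degenerate (V : finType) (e : rel V) (d : nat) :
  (forall v u, e v u = e u v) ->
  (forall W : {set V}, W != set0 -> exists2 v, v \in W & #|[set u in W | e v u]| <= d)%N ->
  forall W : {set V}, (\sum_(v in W) #|[set u in W | e v u]| <= d.*2 * #|W|)%N.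
Proof.
move=> esym low W; move: {2}#|W| (leqnn #|W|) => n.
elim: n W => [|n IH] W Wn.
  by move: Wn; rewrite leqn0 cards_eq0 => /eqP ->; rewrite big_set0.
have [->|W0] := eqVneq W set0; first by rewrite big_set0.
have [v vW vd] := low W W0.
have card_nbr u : #|[set x in W | e u x]| = (e u v + #|[set x in W :\ v | e u x]|)%N.
  rewrite (cardsD1 v) inE vW /=; congr (_ + _)%N; apply: eq_card => x.
  by rewrite !inE; case: (x == v) => //=; case: (x \in W).
rewrite (big_setD1 v vW) /= (eq_bigr _ (fun u _ => card_nbr u)) big_split /=.
have -> : (\sum_(i in W :\ v) e i v = #|[set x in W :\ v | e v x]|)%N.
  rewrite -sum1_card big_mkcond [RHS]big_mkcond; apply: eq_bigr => u _.
  by rewrite inE; case: (u \in _) => //=; rewrite esym; case: (e v u).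
have Wv : (#|W| = #|W :\ v|.+1)%N by rewrite (cardsD1 v) vW.
have vd' : (#|[set x in W :\ v | e v x]| <= d)%N.
  by apply: leq_trans vd; rewrite card_nbr leq_addl.
have := IH (W :\ v) _; rewrite -ltnS -Wv => /(_ Wn) IHv.
rewrite addnA Wv mulnS leq_add // -addnn leq_add //.
Qed.

Lemma sqr_sum_leq (I : finType) (f : I -> nat) :
  ((\sum_i f i) ^ 2 <= #|I| * \sum_i f i ^ 2)%N.
Proof.
rewrite -(leq_pmul2l (isT : 0 < 2)%N) -mulnn big_distrlr /= big_distrr /=.
apply: (@leq_trans (\sum_i \sum_j (f i ^ 2 + f j ^ 2))%N).
  apply: leq_sum => i _; rewrite big_distrr; apply: leq_sum => j _.
  exact: nat_Cauchy.
under eq_bigr => i _ do rewrite big_split sum_nat_const /=.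
rewrite big_split sum_nat_const /= -big_distrr /=.
by rewrite mul2n -addnn.
Qed.

Lemma card_sum_mem (U : finType) (A : {set U}) : #|A| = (\sum_u (u \in A))%N.
Proof. by rewrite -sum1_card big_mkcond; apply: eq_bigr => u _; case: (u \in A). Qed.

(** Cauchy-Schwarz over the fibres of [g] above [P]; two points of one fibre collide. *)
Lemma collisions_lower_bound (T : finType) (Y : choiceType) (g : T -> Y) (P : {fset Y}) :
  (#|[set t | g t \in P]| ^ 2 <= #|` P| * #|[set t : T * T | g t.1 == g t.2]|)%N.
Proof.
have fiber x : (\sum_(y : P) (x == val y) = (x \in P))%N.
  have [xP|xP] := boolP (x \in P).
    rewrite (bigD1 [` xP]%fset) //= eqxx big1 // => y yx.
    by apply/eqP; rewrite eqb0; apply: contraNneq yx => xy; apply/eqP/val_inj; rewrite /= -xy.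
  by rewrite big1 // => y _; apply/eqP; rewrite eqb0; apply: contraNneq xP => ->; exact: valP.
have -> : #|[set t | g t \in P]| = (\sum_(y : P) #|[set t | g t == val y]|)%N.
  rewrite card_sum_mem (eq_bigr (fun t => \sum_(y : P) (g t == val y))%N) => [|t _].
    by rewrite exchange_big; apply: eq_bigr => y _; rewrite card_sum_mem; apply: eq_bigr => t _; rewrite inE.
  by rewrite inE fiber.
rewrite cardfE (leq_trans (sqr_sum_leq _)) // leq_mul2l; apply/orP; right.
rewrite [leqRHS]card_sum_mem.
apply: (@leq_trans (\sum_(t : T * T) \sum_(y : P) (g t.1 == g t.2) * (g t.1 == val y))%N); last first.
  apply: leq_sum => t _; rewrite -big_distrr /= fiber inE.
  by case: (g t.1 == _); rewrite ?mul1n // leq_b1.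
rewrite exchange_big; apply: leq_sum => y _.
rewrite -mulnn -cardsX card_sum_mem; apply: leq_sum => -[t t'] _; rewrite !inE /=.
by case: eqP => //= ->; case: eqP => //= ->; rewrite eqxx.
Qed.

(** * The rays attached to the collision equation *)

Section Configuration.
Variables (F K : fieldType) (io : {rmorphism F -> K}) (th : K).
Variables (I J : finType) (al : I -> F) (be : J -> F).
Hypothesis th_free : forall c0 c1 c2 c3,
  io c0 + io c1 * th + io c2 * th ^+ 2 + io c3 * th ^+ 3 = 0 ->
  [/\ c0 = 0, c1 = 0, c2 = 0 & c3 = 0].
Hypotheses (al_inj : injective al) (be_inj : injective be).
Hypothesis al_neq0 : forall i, al i != 0.

Local Notation T := (I * I * J)%type.

Let th_neq0 : th != 0.
Proof.
apply/eqP => th0; have [|_ /eqP] := @th_free 0 1 0 0; last by rewrite oner_eq0.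
by rewrite th0 !rmorph0; ring.
Qed.

(* inl (a', b', x) and inr (a, b, x') meet iff a (x - b) = a' (x' - b').  The
   powers of the transcendental th put the two families in general position:
   two rays of the same family never meet. *)
Let ray_s (v : T + T) : K := match v with
  | inl (i, _, _) => io (al i)
  | inr (i, _, _) => - (io (al i) + th ^+ 2) / th ^+ 3 end.
Let ray_y (v : T + T) : K := match v with
  | inl (_, _, j) => th ^+ 3 * io (be j)
  | inr (_, _, j) => th - io (be j) end.
Let ray_w (v : T + T) : K := match v with
  | inl (i, i', j) => io (al i) * io (al i') - th * io (al i) - th ^+ 2 * io (be j)
  | inr (i, i', j) => io (al i) * io (al i') end.

Let inc (r b : T) := let: (i, i', j) := r in let: (k, k', l) := b in
  al k * (be j - al k') == al i * (be l - al i').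

Let e (v u : T + T) := match v, u with
  | inl r, inr b => inc r b | inr b, inl r => inc r b | _, _ => false end.

Let e_sym v u : e v u = e u v.
Proof. by case: v; case: u. Qed.

(** Equal slopes would give a cubic relation in [th] with coefficient 1 at th^2. *)
Let e_slope v u : e v u -> ray_s v != ray_s u.
Proof.
have rb (r b : T) : ray_s (inl r) != ray_s (inr b).
  case: r b => [[i i'] j] [[k k'] l] /=; apply/eqP => h.
  have : io (al k) + io 0 * th + io 1 * th ^+ 2 + io (al i) * th ^+ 3 = 0.
    by rewrite h rmorph0 rmorph1; field.
  by case/th_free => _ _ /eqP; rewrite oner_eq0.
by case: v u => [r|b] [r'|b'] //= _; rewrite ?rb // eq_sym rb.
Qed.

Let e_meet v u : e v u -> meet ray_s ray_y ray_w v u.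
Proof.
have rb (r b : T) : inc r b -> meet ray_s ray_y ray_w (inl r) (inr b).
  case: r b => [[i i'] j] [[k k'] l] /= /eqP h; rewrite /meet /=.
  have {}h : io (al k) * (io (be j) - io (al k')) = io (al i) * (io (be l) - io (al i')).
    by rewrite -!rmorphB -!rmorphM h.
  apply/eqP/subr0_eq; rewrite -[RHS](subrr (io (al k) * (io (be j) - io (al k')))) {2}h.
  by field.
have sym v' u' : meet ray_s ray_y ray_w v' u' -> meet ray_s ray_y ray_w u' v'.
  by rewrite /meet => /eqP h; apply/eqP; rewrite -opprB h opprB.
by case: v u => [r|b] [r'|b'] //= h; rewrite ?rb // sym ?rb.
Qed.

(** Two neighbours of [v] belong to the same family; if they meet, the coefficients of a cubic
    relation in [th] identify their index triples. *)
Let nbr_skew v u u' : e v u -> e v u' -> u != u' -> ~~ meet ray_s ray_y ray_w u u'.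
Proof.
move=> vu vu'; apply: contraNN => /eqP h; apply/eqP; move: h.
have cancel3 i i' j k k' l : [/\ al i = al k, be j = be l & al i * al i' = al k * al k'] ->
    (i, i', j) = (k, k', l).
  case=> /al_inj -> /be_inj -> /(mulfI (al_neq0 _))/al_inj -> //.
case: v u u' vu vu' => [v|v] [[[i i'] j]|[[i i'] j]] [[[k k'] l]|[[k k'] l]] //= _ _ h; (congr (inl _) || congr (inr _)).
  have : io (al k * be j - al i * be l) + io (al i - al k) * th
     + io (be j - be l) * th ^+ 2 + io (al k * al k' - al i * al i') * th ^+ 3 = 0.
    move/eqP: h; rewrite -subr_eq0 => /eqP h.
    by rewrite -[RHS](mulr0 (- th ^+ 3)) -h !rmorphB !rmorphM; field.
  by case/th_free => _ /subr0_eq ? /subr0_eq ? /subr0_eq ?; apply: cancel3.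
have : io (al i * al i' - al k * al k') + io (al k - al i) * th
   + io (be l - be j) * th ^+ 2 + io (al i * be l - al k * be j) * th ^+ 3 = 0.
  move/eqP: h; rewrite -subr_eq0 => /eqP <-.
  by rewrite !rmorphB !rmorphM; ring.
by case/th_free => /subr0_eq ? /subr0_eq ? /subr0_eq ? _; apply: cancel3.
Qed.

(** If c1 = 0, the slope and so the first index is fixed, and incidence recovers the third index
    from the second. Otherwise the first index determines the slope, hence [ray_y] and the third
    index, and incidence gives the second. *)
Let nbr_pencil v (c0 c1 : K) :
  (#|[set u | e v u & (c0 * (ray_s v - ray_s u) + c1 * (ray_y u - ray_y v) == 1)%R]|
    <= #|I|)%N.
Proof.
have card_le (X : {set T + T}) (f : T + T -> I) : {in X &, injective f} -> (#|X| <= #|I|)%N.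
  by move/card_in_imset <-; apply: max_card.
have io_inj : injective io by apply: fmorph_inj.
pose fst3 (v : T + T) := match v with inl (i, _, _) => i | inr (i, _, _) => i end.
pose snd3 (v : T + T) := match v with inl (_, i, _) => i | inr (_, i, _) => i end.
have [c10|c10] := eqVneq c1 0.
  have [c00|c00] := eqVneq c0 0.
    rewrite (_ : [set _ | _] = set0) ?cards0 //; apply/setP => u.
    by rewrite !inE c10 c00 !mul0r addr0 eq_sym oner_eq0 andbF.
  apply: (card_le _ snd3) => u u'; rewrite !inE c10 !mul0r !addr0.
  move=> /andP[vu /eqP uc] /andP[vu' /eqP uc'] uu'.
  have {uc uc'} suu' : ray_s u = ray_s u'.
    by apply: oppr_inj; apply: (addrI (ray_s v)); apply: (mulfI c00); rewrite uc.
  case: v u u' vu vu' uu' suu' => [[[i i'] j]|[[k k'] l]];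
      case=> -[[x x'] z] //; case=> -[[t t'] r] //= /eqP vu /eqP vu' xt.
    move/(mulIf (invr_neq0 (expf_neq0 3 th_neq0)))/oppr_inj/addIr/io_inj/al_inj => xt'.
    by move: vu'; rewrite -xt -xt' vu => /(mulfI (al_neq0 _))/addIr/be_inj <-.
  move/io_inj/al_inj => xt'; move: vu; rewrite xt xt' -vu'.
  by move/(mulfI (al_neq0 _))/addIr/be_inj <-.
apply: (card_le _ fst3) => u u'; rewrite !inE.
move=> /andP[vu /eqP uc] /andP[vu' /eqP uc'] uu'.
have suu' : ray_s u = ray_s u'.
  case: v u u' vu vu' uu' {uc uc'} => [[[i i'] j]|[[k k'] l]];
    by case=> -[[x x'] z] //; case=> -[[t t'] r] //= _ _ ->.
have {uc uc'} yuu' : ray_y u = ray_y u'.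
  apply: (addIr (- ray_y v)); apply: (mulfI c10).
  by apply: (addrI (c0 * (ray_s v - ray_s u))); rewrite uc suu' uc'.
case: v u u' vu vu' uu' yuu' {suu'} => [[[i i'] j]|[[k k'] l]];
    case=> -[[x x'] z] //; case=> -[[t t'] r] //= /eqP vu /eqP vu' xt.
  move/addrI/oppr_inj/io_inj/be_inj => zr; move: vu; rewrite xt zr -vu'.
  by move/(mulfI (al_neq0 _))/addrI/oppr_inj/al_inj <-.
move/(mulfI (expf_neq0 3 th_neq0))/io_inj/be_inj => zr; move: vu'; rewrite -xt -zr vu.
by move/(mulfI (al_neq0 _))/addrI/oppr_inj/al_inj <-.
Qed.

(* A collision of (a, b, x) and (a', b', x') is a meeting of the rays
   (a', b', x) and (a, b, x'). *)
Lemma collisions_upper_bound D m (g := fun t : T => al t.1.1 * (be t.2 - al t.1.2)) :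
  (forall j, (0 < j < m)%N -> j%:R != 0 :> K) ->
  (6 * (#|I| ^ 2 * #|J|) < D ^ 2)%N -> (6 * D <= m)%N ->
  (#|[set t : T * T | g t.1 == g t.2]| <= 4 * (15 * D + #|I|) * (#|I| ^ 2 * #|J|))%N.
Proof.
move=> ch D1 D2.
have cardV : (#|{: T + T}| = 2 * (#|I| ^ 2 * #|J|))%N.
  by rewrite card_sum !card_prod addnn -mul2n mulnn.
have DV : (3 * #|{: T + T}| < D ^ 2)%N by rewrite cardV mulnA.
have low := exists_low_degree ch DV D2 e_slope e_meet nbr_skew nbr_pencil.
have := sum_degrees_degenerate e_sym low setT.
rewrite cardsT cardV => deg.
rewrite (_ : 4 * _ * _ = (15 * D + #|I|).*2 * (2 * (#|I| ^ 2 * #|J|)))%N; last by lia.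
apply: leq_trans deg.
rewrite (eq_bigl xpredT) => [|v]; last by rewrite inE.
pose swap (tt : T * T) : T * T := ((tt.2.1, tt.1.2), (tt.1.1, tt.2.2)).
pose X := [set rb : T * T | inc rb.1 rb.2].
apply: (@leq_trans #|X|).
  have sw_inj : injective swap.
    by move=> [[[? ?] ?] [[? ?] ?]] [[[? ?] ?] [[? ?] ?]] [-> -> -> -> -> ->].
  rewrite -(card_imset _ sw_inj) subset_leq_card //; apply/subsetP => _ /imsetP[[[[a b] x] [[a' b'] x']] + ->].
  by rewrite !inE.
(* The degrees in the first family alone already count every meeting. *)
rewrite big_sumType /= (leq_trans _ (leq_addr _ _)) //.
have -> : #|X| = (\sum_r #|[set b | inc r b]|)%N.
  rewrite card_sum_mem (eq_bigr (fun r => \sum_b inc r b)%N) => [|r _]; last first.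
    by rewrite card_sum_mem; apply: eq_bigr => b _; rewrite inE.
  by rewrite pair_bigA; apply: eq_bigr => rb _; rewrite inE.
apply: leq_sum => r _; rewrite -(card_imset _ (@inr_inj T T)) subset_leq_card //.
by apply/subsetP => _ /imsetP[b + ->]; rewrite !inE.
Qed.
End Configuration.

(** * Specialisation to F(T) and the numerical conclusion *)

Lemma fraction_X_free (F : fieldType) (c0 c1 c2 c3 : F) (th := tofrac ('X : {poly F})) :
  tofrac c0%:P + tofrac c1%:P * th + tofrac c2%:P * th ^+ 2 + tofrac c3%:P * th ^+ 3 = 0 ->
  [/\ c0 = 0, c1 = 0, c2 = 0 & c3 = 0].
Proof.
rewrite /th -!rmorphXn -!rmorphM -!rmorphD /= => /eqP.
rewrite tofrac_eq0 => /eqP/polyP h.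
have := (h 0, h 1, h 2, h 3)%N.
rewrite !coef0 !coefD !coefMXn !coefMX !coefC /= !add0r !addr0.
by case=> [[[]]].
Qed.

(** Passing to F(T) supplies a transcendental [th] for any F and keeps the characteristic, so [m]
    can be p. *)
Lemma collisions_pchar (F : fieldType) (p : nat) (I J : finType) (al : I -> F) (be : J -> F)
    (D : nat) (g := fun t : I * I * J => al t.1.1 * (be t.2 - al t.1.2)) :
  p \in [pchar F] -> injective al -> injective be -> (forall i, al i != 0) ->
  (6 * (#|I| ^ 2 * #|J|) < D ^ 2)%N -> (6 * D <= p)%N ->
  (#|[set t : (I * I * J) * (I * I * J) | g t.1 == g t.2]|
    <= 4 * (15 * D + #|I|) * (#|I| ^ 2 * #|J|))%N.
Proof.
move=> pF al_inj be_inj al0 D1 D2.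
pose io : {rmorphism F -> {fraction {poly F}}} := @tofrac {poly F} \o polyC.
have free c0 c1 c2 c3 := @fraction_X_free F c0 c1 c2 c3.
apply: (@collisions_upper_bound _ _ io _ _ _ _ _ free al_inj be_inj al0 D p _ D1 D2).
move=> j /andP[j0 jp]; rewrite -(rmorph_nat io) fmorph_eq0 -(dvdn_pcharf pF).
by rewrite gtnNdvd.
Qed.

(** For the least D, (D - 1)^2 <= 6n and D <= 2 (D - 1). *)
Lemma exists_sqr_between (n : nat) : (0 < n)%N ->
  exists2 D, (6 * n < D ^ 2)%N & (D ^ 2 <= 24 * n)%N.
Proof.
move=> n0; have ex : exists D, (6 * n < D ^ 2)%N by exists (6 * n).+1; rewrite -mulnn; nia.
case: (ex_minnP ex) => -[|d] // dn dmin; exists d.+1 => //.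
have dle : (d ^ 2 <= 6 * n)%N.
  by rewrite leqNgt; apply/negP => /dmin; rewrite ltnn.
move: dn dle; rewrite -!mulnn; nia.
Qed.

Lemma sum_product_nat (F : fieldType) (p : nat) (A S P : {fset F}) :
  p \in [pchar F] -> 0 \notin A -> (0 < #|` A|)%N -> (#|` A| ^ 5 < p ^ 3)%N ->
  {in A &, forall a b, a + b \in S} -> {in A &, forall a b, a * b \in P} ->
  (#|` A| ^ 6 <= 864 ^ 3 * (#|` S| ^ 3 * #|` P| ^ 2))%N.
Proof.
move=> pF A0 An Ap AS AP.
have val_neq0 (a : A) : val a != 0.
  by apply: contraNneq A0 => <-; exact: valP.
have [a0 a0A] : exists a, a \in A by apply/fset0Pn; rewrite -cardfs_gt0.
have S_gt0 : (0 < #|` S|)%N by rewrite cardfs_gt0; apply/fset0Pn; exists (a0 + a0); exact: AS.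
have AleP : (#|` A| <= #|` P|)%N.
  have <- : #|` [fset a0 * b | b in A]%fset| = #|` A|.
    by rewrite card_imfset //; exact: (mulfI (val_neq0 [` a0A]%fset)).
  apply/fsubset_leq_card/fsubsetP => _ /imfsetP[b /= bA ->]; exact: AP.
pose g (t : A * A * S) : F := val t.1.1 * (val t.2 - val t.1.2).
have lower := collisions_lower_bound g P.
(* The triple (a, b, b + c) has the value a c, which lies in [P]. *)
have many : (#|` A| ^ 3 <= #|[set t | g t \in P]|)%N.
  pose f (t : A * A * A) : A * A * S :=
    (t.1, [` AS _ _ (valP t.1.2) (valP t.2)]%fset).
  have f_inj : injective f.
    move=> [[a b] c] [[a' b'] c'] /= [-> -> bc].
    by move/addrI: bc => /val_inj ->.
  rewrite !expnS expn0 muln1 mulnA cardfE -!card_prod -(card_imset _ f_inj).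
  apply/subset_leq_card/subsetP => _ /imsetP[[[a b] c] _ ->].
  by rewrite inE /g /= addrAC subrr add0r AP ?valP.
move: An Ap AleP S_gt0 lower many.
set N := #|` A|; set s := #|` S|; set q := #|` P|; set E := #|[set t : _ * _ | _]|.
set M := #|[set t | _]| => N0 Np Nq s0 ME NM.
have NE : (N ^ 6 <= q * E)%N.
  by apply: leq_trans ME; rewrite (expnM N 3 2) leq_exp2r.
have n0 : (0 < N ^ 2 * s)%N by rewrite muln_gt0 expn_gt0 N0.
have uE : ((N ^ 2 * s) ^ 3 = N ^ 6 * s ^ 3)%N by rewrite expnMn -expnM.
have [D D1 D2] := exists_sqr_between n0.
have [Dp|Dp] := leqP (6 * D) p; last first.
  (* Since p < 6D and D^2 <= 24 N^2 s, the constant is 36 * 24 = 864. *)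
  have pn : (p ^ 2 <= 864 * (N ^ 2 * s))%N.
    by move: Dp D2; rewrite -!mulnn; move: (N * N * s)%N => u; nia.
  have N10 : (N ^ 10 <= 864 ^ 3 * (N ^ 2 * s) ^ 3)%N.
    apply: (@leq_trans ((p ^ 2) ^ 3)%N); last by rewrite -expnMn leq_exp2r.
    by rewrite -expnM mulnC expnM (expnM N 5 2) leq_exp2r // ltnW.
  have N4 : (N ^ 4 <= 864 ^ 3 * s ^ 3)%N.
    rewrite -(@leq_pmul2l (N ^ 6)) ?expn_gt0 ?N0 // -expnD.
    by rewrite mulnCA -uE.
  by rewrite (expnD N 4 2) mulnA leq_mul // leq_exp2r.
have upper : (E <= 4 * (15 * D + N) * (N ^ 2 * s))%N.
  by rewrite /N /s !cardfE; apply: (collisions_pchar pF val_inj val_inj val_neq0 _ Dp); rewrite -!cardfE.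
have [K DN K864] : exists2 K, ((15 * D + N) ^ 2 <= K * (N ^ 2 * s))%N & (16 * K <= 864 ^ 3)%N.
  (* This is 2 (225 * 24 + 1), factored so that 16 K and 864^3 compare factor by factor. *)
  exists (22 * 491)%N; last by rewrite !expnS expn0 muln1 !leq_mul.
  have Nu : (N ^ 2 <= N ^ 2 * s)%N by rewrite leq_pmulr.
  rewrite sqrnD; have := (nat_Cauchy (15 * D) N).1.
  rewrite expnMn (_ : 15 ^ 2 = 225)%N //; move: D2 Nu.
  by move: (N ^ 2 * s)%N => u; lia.
have E2 : (E ^ 2 <= 16 * K * (N ^ 2 * s) ^ 3)%N.
  apply: (@leq_trans ((4 * (15 * D + N) * (N ^ 2 * s)) ^ 2)); first by rewrite leq_exp2r.
  by rewrite 2!expnMn (expnS _ 2) [leqRHS]mulnA leq_mul // -(mulnA 16) leq_mul.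
(* Squaring [NE] gives N^12 <= q^2 E^2 <= 16 K q^2 N^6 s^3, from which N^6 cancels. *)
rewrite -(@leq_pmul2l (N ^ 6)) ?expn_gt0 ?N0 //.
apply: (@leq_trans (q ^ 2 * E ^ 2)%N); first by rewrite -expnD (expnM N 6 2) -expnMn leq_exp2r.
apply: (leq_trans (leq_mul (leqnn _) E2)); rewrite uE.
rewrite (_ : q ^ 2 * _ = 16 * K * (N ^ 6 * (s ^ 3 * q ^ 2)))%N; last by ring.
by rewrite [leqRHS]mulnCA leq_mul.
Qed.

Theorem proposition1 (R : realType) :
  exists2 c : R, 0 < c &
    forall (F : fieldType) (p : nat) (A : {fset F}),
      p \in [pchar F] -> odd p ->
      0 \notin A ->
      (1 < #|` A|)%N ->
      (#|` A|%:R : R) < p%:R `^ (3%:R / 5%:R) ->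
      c * #|` A|%:R ^+ 6
        <= #|` sumset A A|%:R ^+ 3 * #|` prodset A A|%:R ^+ 2.
Proof.
exists (864%:R ^+ 3)^-1; first by rewrite invr_gt0 exprn_gt0 // ltr0n.
move=> F p A pF _ A0 A1 Ap.
have {}Ap : (#|` A| ^ 5 < p ^ 3)%N.
  rewrite -(ltr_nat R) !natrX.
  have -> : p%:R ^+ 3 = (p%:R `^ (3%:R / 5%:R)) ^+ 5 :> R.
    by rewrite -[RHS]powR_mulrn ?powR_ge0 // -powRrM divfK ?pnatr_eq0 // powR_mulrn.
  by rewrite ltrXn2r ?ler0n ?powR_ge0.
rewrite ler_pdivrMl ?exprn_gt0 ?ltr0n // -!natrX -!natrM ler_nat.
apply: (sum_product_nat pF A0 (ltnW A1) Ap) => a b aA bA.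
  exact: in_imfset2.
exact: in_imfset2.
Qed.
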